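(* On any given board, the set of reachable positions of even size is closed under addition: if $P_1$ and $P_2$ are reachable positions of even size on the same board, then $P_1 + P_2$ is a reachable position of even size.
   Context: A column is an infinite vertical stack of cells (with a bottom cell, and unbounded upward), and a board is a finite sequence of columns (so the columns are distinguishable). A position on a board is a placement of finitely many tokens in cells such that each token is either red or yellow, no two tokens occupy the same cell, and the occupied cells in each column form a contiguous block starting from the bottom. Equivalently, a position on an $n$-column board is an $n$-tuple of finite words over $\{R,Y\}$, each column being read from bottom to top. The size of a position is its number of tokens. A reachable position is one that can be obtained from the empty board by a finite sequence of moves, where each move inserts a token into the lowest empty cell of some column, and the inserted tokens alternate globally between red and yellow from move to move, the first move placing a red token. There is no win condition. The sum $P_1+P_2$ of two positions on the same board is defined by column-wise concatenation: in each column, the word of $P_1+P_2$ (read bottom to top) is the word of $P_1$ followed by the word of $P_2$, i.e. $P_2$ is stacked on top of $P_1$. *)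

(* Defs.v *)
From mathcomp Require Import all_boot.

Set Implicit Arguments.
Unset Strict Implicit.
Unset Printing Implicit Defensive.

Inductive token : Type := Red | Yellow.

Definition other (c : token) : token :=
  match c with Red => Yellow | Yellow => Red end.

(* Each column is the word of its tokens read from bottom to top, so its
   occupied cells form a contiguous block starting from the bottom. *)
Definition position (n : nat) : Type := {ffun 'I_n -> seq token}.

Definition empty_position (n : nat) : position n := [ffun _ => [::]].

Definition position_size (n : nat) (P : position n) : nat :=
  \sum_(i < n) size (P i).

(* The lowest empty cell of a column is just past the end of its word. *)
Definition insert (n : nat) (P : position n) (i : 'I_n) (c : token) :
    position n :=
  [ffun j => if j == i then rcons (P j) c else P j].

(* [play c P]: some sequence of alternating moves, the first one red, leads
   from the empty board to [P], and [c] is the colour of the next token. *)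
Inductive play (n : nat) : token -> position n -> Prop :=
| play_start : play Red (empty_position n)
| play_move (c : token) (P : position n) (i : 'I_n) :
    play c P -> play (other c) (insert P i c).

Definition reachable (n : nat) (P : position n) : Prop :=
  exists c : token, play c P.

Definition position_add (n : nat) (P1 P2 : position n) : position n :=
  [ffun i => P1 i ++ P2 i].

(* Main.v *)
Require Import Defs.
From mathcomp Require Import all_boot.

(** After evenly many moves it is red's turn again, exactly as on the empty board. So once [P1] has
    been reached, a play leading to [P2] can be replayed with the same columns and colours, stacking
    [P2] on [P1]. [play_next_token] supplies the parity argument and [play_add] the replay. *)

Lemma position_size_insert (n : nat) (P : position n) (i : 'I_n) (c : token) :
  position_size (insert P i c) = (position_size P).+1.
Proof.
rewrite /position_size (bigD1 i) //= (bigD1 i (F := fun j => size (P j))) //=.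
rewrite ffunE eqxx size_rcons addSn; congr (_ + _).+1.
by apply: eq_bigr => j /negPf ne_ji; rewrite ffunE ne_ji.
Qed.

Lemma position_size_add (n : nat) (P1 P2 : position n) :
  position_size (position_add P1 P2) = position_size P1 + position_size P2.
Proof.
by rewrite -big_split; apply: eq_bigr => i _; rewrite ffunE size_cat.
Qed.

(** Each move flips both the colour to come and the parity of the size. *)
Lemma play_next_token (n : nat) (c : token) (P : position n) :
  play c P -> c = if odd (position_size P) then Yellow else Red.
Proof.
elim=> [|{}c {}P i _ ->].
  by rewrite /position_size big1 // => i _; rewrite ffunE.
by rewrite position_size_insert /=; case: (odd _).
Qed.

(** Induction on the play of [P2]: its start is replaced by the play of [P1], which must therefore
    leave red to move, and each later insertion commutes with stacking on [P1]. *)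
Lemma play_add (n : nat) (c : token) (P1 P2 : position n) :
  play Red P1 -> play c P2 -> play c (position_add P1 P2).
Proof.
move=> play1; elim=> [|{}c P i _ playP].
  suff -> : position_add P1 (empty_position n) = P1 by [].
  by apply/ffunP => j; rewrite !ffunE cats0.
suff -> : position_add P1 (insert P i c) = insert (position_add P1 P) i c.
  exact: play_move.
by apply/ffunP => j; rewrite !ffunE; case: eqP => // _; rewrite rcons_cat.
Qed.

Theorem proposition8 (n : nat) (P1 P2 : position n)
  (reach1 : reachable P1) (even1 : ~~ odd (position_size P1))
  (reach2 : reachable P2) (even2 : ~~ odd (position_size P2)) :
  reachable (position_add P1 P2) /\
  ~~ odd (position_size (position_add P1 P2)).
Proof.
split; last by rewrite position_size_add oddD (negPf even1) (negPf even2).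
case: reach1 reach2 => [c1 play1] [c2 play2]; exists c2.
apply: play_add play2.
(* Evenness of [P1] forces [c1] to be [Red]. *)
by have := play_next_token _ _ _ play1; rewrite (negPf even1) => <-.
Qed.
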